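(* Let $r\ge 2$ be an integer and let $\rho$ be the unique root in $[0,1]$ of the equation $\rho^r = (1-\rho)^r + r\rho(1-\rho)^{r-1}$. Then $$\max_G \min\{d(K_r;G),\, d(\overline{K}_r;G)\} = \rho^r + o(1),$$ where the maximum is over all $n$-vertex graphs $G$ and $o(1)$ tends to $0$ as $n\to\infty$ with $r$ fixed.
   Context: Graphs are finite and simple. $K_r$ is the complete graph on $r$ vertices and $\overline{K}_r$ is the edgeless graph on $r$ vertices. For a $k$-vertex graph $H$ and an $n$-vertex graph $G$ (with $n\ge k$), $d(H;G) := |\{X\subseteq V(G): G[X]\simeq H\}|/\binom{n}{k}$ is the induced $H$-density. *)

(* Defs.v *)
From HB Require Import structures.
From mathcomp Require Import all_boot all_order all_algebra.
From mathcomp Require Import all_classical all_reals all_analysis.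

Set Implicit Arguments.
Unset Strict Implicit.
Unset Printing Implicit Defensive.

Import Order.TTheory GRing.Theory Num.Theory.
Import numFieldNormedType.Exports.

Local Open Scope ring_scope.

Definition sgraph_axiom (T : finType) (e : {ffun T * T -> bool}) : bool :=
  [forall x, ~~ e (x, x)] && [forall x, forall y, e (x, y) == e (y, x)].

(* The adjacency relation is stored as a finite function so that the graphs on
   a given finite vertex type themselves form a finite type. *)
Record sgraph (T : finType) := SGraph {
  sgraph_val : {ffun T * T -> bool};
  _ : sgraph_axiom sgraph_val
}.

HB.instance Definition _ (T : finType) := [isSub for @sgraph_val T].
HB.instance Definition _ (T : finType) := [Finite of sgraph T by <:].

Definition adj (T : finType) (G : sgraph T) : rel T :=
  fun x y => sgraph_val G (x, y).

Lemma adj_irr (T : finType) (G : sgraph T) : irreflexive (adj G).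
Proof. by have /andP[/forallP he _] := valP G => x; apply/negbTE/he. Qed.

Lemma adj_sym (T : finType) (G : sgraph T) : symmetric (adj G).
Proof.
have /andP[_ /forallP he] := valP G.
by move=> x y; have /forallP/(_ y)/eqP := he x.
Qed.

Fact sgraph_of_subproof (T : finType) (e : rel T) :
  irreflexive e -> symmetric e -> sgraph_axiom [ffun p => e p.1 p.2].
Proof.
move=> ei es; apply/andP; split; first by apply/forallP => x; rewrite ffunE ei.
by apply/forallP => x; apply/forallP => y; rewrite !ffunE /= es.
Qed.

Definition sgraph_of (T : finType) (e : rel T) (ei : irreflexive e)
    (es : symmetric e) : sgraph T :=
  SGraph (sgraph_of_subproof ei es).

Lemma adj_sgraph_of (T : finType) (e : rel T) (ei : irreflexive e)
    (es : symmetric e) x y : adj (sgraph_of ei es) x y = e x y.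
Proof. by rewrite /adj ffunE. Qed.

Fact complete_irr (r : nat) : irreflexive (fun i j : 'I_r => i != j).
Proof. by move=> i; rewrite eqxx. Qed.

Fact complete_sym (r : nat) : symmetric (fun i j : 'I_r => i != j).
Proof. by move=> i j; rewrite eq_sym. Qed.

Definition complete (r : nat) : sgraph 'I_r :=
  sgraph_of (@complete_irr r) (@complete_sym r).

Definition edgeless (r : nat) : sgraph 'I_r :=
  @sgraph_of 'I_r (fun _ _ => false) (fun=> erefl) (fun _ _ => erefl).

Fact induced_irr (T : finType) (G : sgraph T) (X : {set T}) :
  irreflexive (fun x y : {x : T | x \in X} => adj G (val x) (val y)).
Proof. by move=> x; exact: adj_irr. Qed.

Fact induced_sym (T : finType) (G : sgraph T) (X : {set T}) :
  symmetric (fun x y : {x : T | x \in X} => adj G (val x) (val y)).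
Proof. by move=> x y; exact: adj_sym. Qed.

Definition induced (T : finType) (G : sgraph T) (X : {set T}) :
    sgraph {x : T | x \in X} :=
  sgraph_of (@induced_irr T G X) (@induced_sym T G X).

Definition isomorphic (U V : finType) (G : sgraph U) (H : sgraph V) : Prop :=
  exists2 f : U -> V, bijective f & forall x y, adj H (f x) (f y) = adj G x y.

(* When G has fewer vertices than H the binomial coefficient is 0, and the
   density is then 0 because division by 0 gives 0. *)
Definition density (R : realType) (U T : finType) (H : sgraph U)
    (G : sgraph T) : R :=
  #|[pred X : {set T} | `[< isomorphic (induced G X) H >]]|%:R
    / 'C(#|T|, #|U|)%:R.

(* Densities are nonnegative and there is at least one graph on 'I_n, so the
   default value 0 of the iterated maximum does not affect its value. *)
Definition max_min_density (R : realType) (r n : nat) : R :=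
  \big[Num.max/0]_(G : sgraph 'I_n)
    Num.min (density R (complete r) G) (density R (edgeless r) G).

(* Main.v *)
(* Replacing the neighbourhoods of two vertices by their union and their
   intersection does not decrease the number of cliques or of edgeless sets of
   any size, so one may assume that some vertex is dominating or isolated and,
   inductively, that G is a threshold graph. Such a graph is a lattice path from
   (0, 0) to (X, Y) with X + Y = n: up to lower order terms, r! times the two
   counts are X^r + r u and Y^r + r v, with u = sum X^(r-1) over the Y-steps and
   v = sum Y^(r-1) over the X-steps. An invariant of the path shows that, for
   given X, Y and u, v is at most the value on a path with three blocks (one
   block of X-steps between two of Y-steps, or the mirror image). Along the
   three-block paths whose first density equals rho^r, the second density is
   quasiconvex, hence maximal at the two ends, where it equals rho^r: a clique
   with isolated vertices, and the complement of such a graph. *)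

Require Import Defs.
From mathcomp Require Import all_boot fingroup perm.

Set Implicit Arguments.
Unset Strict Implicit.
Unset Printing Implicit Defensive.

(** * Reduction to threshold graphs *)

Section Cliques.
Variable T : finType.
Implicit Types (e : rel T) (S X : {set T}) (u v w x y : T).

Definition clique e X :=
  [forall x in X, forall y in X, (x != y) ==> e x y].

Lemma cliqueP e X :
  reflect {in X &, forall x y, x != y -> e x y} (clique e X).
Proof.
apply: (iffP 'forall_in_'forall_in_implyP) => h x.
  by move=> y xX yX; exact: h.
by move=> xX y yX; exact: h.
Qed.

Definition cliques e S k : {set {set T}} :=
  [set X : {set T} | [&& X \subset S, #|X| == k & clique e X]].

(** Edgeless sets are counted as cliques of the complement. *)
Definition co_rel e : rel T := fun x y => (x != y) && ~~ e x y.

Lemma eq_cliques e e' S k : e =2 e' -> cliques e S k = cliques e' S k.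
Proof.
move=> ee'; apply/setP => X; rewrite !inE; congr [&& _, _ & _].
by apply/cliqueP/cliqueP => h x y xX yX xy; move: (h x y xX yX xy); rewrite ee'.
Qed.

(** For symmetric [e], the neighbours of [v] outside the pair [u], [v] become the union and those of
    [u] the intersection; all other adjacencies, that of [u] and [v] included, stay. *)
Definition shift e u v : rel T := fun x y =>
  let e' := e (tperm u v x) (tperm u v y) in
  if (x == v) || (y == v) then e x y || e' else e x y && e'.

Lemma shift_sym e u v : symmetric e -> symmetric (shift e u v).
Proof. by move=> es x y; rewrite /shift orbC !(es x) !(es (tperm u v x)). Qed.

Lemma shift_irr e u v : irreflexive e -> irreflexive (shift e u v).
Proof. by move=> ei x; rewrite /shift !ei; case: ifP. Qed.

(** Complementation exchanges union and intersection, so [u] and [v] swap roles. Bounds for edgeless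
    sets thus follow from those for cliques. *)
Lemma co_shift e u v : symmetric e ->
  co_rel (shift e u v) =2 shift (co_rel e) v u.
Proof.
move=> es x y; rewrite /co_rel /shift !(inj_eq perm_inj) (tpermC v u).
have [->|/negPf uv] := eqVneq u v.
  by rewrite tperm1 !perm1 !orbb !andbb !if_same.
case: tpermP => [->|->|/eqP/negPf xu /eqP/negPf xv];
  case: tpermP => [->|->|/eqP/negPf yu /eqP/negPf yv];
  rewrite ?eqxx ?orbT ?xu ?yu ?xv ?yv ?uv 1?(eq_sym v u) ?uv //= ?(es u v) //;
  by rewrite ?negb_and ?negb_or ?andb_orr ?orbb 1?(andbACA (_ != _)) ?andbb.
Qed.

(** By an injection: a clique that survives is kept, any other is carried to its image under the
    transposition of [u] and [v]. *)
Lemma leq_cliques_shift e S k u v : u \in S -> v \in S ->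
  #|cliques e S k| <= #|cliques (shift e u v) S k|.
Proof.
move=> uS vS; set e' := shift e u v.
pose p := tperm u v; pose f X := if clique e' X then X else p @: X.
have pp X : p @: (p @: X) = X.
  by rewrite -imset_comp -[RHS]imset_id; apply: eq_imset => x; rewrite /= tpermK.
have both X : clique e X -> clique e (p @: X) -> clique e' X.
  move=> /cliqueP h /cliqueP h'; apply/cliqueP => x y xX yX xy; rewrite /e' /shift.
  rewrite h // (h' (p x) (p y)) ?imset_f ?(inj_eq perm_inj) //; by case: ifP.
(* A clique through [v] survives: it is its own image if it contains [u], and otherwise its edges at
   [v] only gain from the union. For a clique without [v], the image takes its edges at [v] from
   those at [u]. *)
have moved X : clique e X -> ~~ clique e' X -> clique e' (p @: X).
  move=> cX; apply: contraR => ncp; have /cliqueP h := cX.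
  have [vX|vX] := boolP (v \in X).
    have [uX|uX] := boolP (u \in X).
      apply: both => //; suff -> : p @: X = X by [].
      apply/eqP; rewrite eqEcard card_imset ?leqnn ?andbT; last exact: perm_inj.
      by apply/subsetP => _ /imsetP[x xX ->]; rewrite /p; case: tpermP => // ->.
    apply/cliqueP => x y xX yX xy; rewrite /e' /shift.
    rewrite (h x y) //=; case: ifPn => //; rewrite negb_or => /andP[xv yv].
    by rewrite !tpermD ?h //; [case: eqP uX yX => // -> /negPf->|
      rewrite eq_sym|case: eqP uX xX => // -> /negPf->|rewrite eq_sym].
  case/negP: ncp; apply/cliqueP => _ _ /imsetP[x xX ->] /imsetP[y yX ->].
  rewrite (inj_eq perm_inj) => xy; rewrite /e' /shift !tpermK (h x y) //=.
  rewrite orbT andbT; case: ifPn => //; rewrite negb_or => /andP[xv yv].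
  have nu z : p z != v -> u != z.
    by apply: contra => /eqP<-; rewrite /p tpermL.
  have nv z : z \in X -> v != z by apply: contraL => /eqP<-.
  by rewrite !tpermD ?h ?nu ?nv.
have pS X : X \subset S -> p @: X \subset S.
  move=> /subsetP XS; apply/subsetP => _ /imsetP[x /XS xS ->].
  by rewrite /p; case: tpermP.
rewrite -(@card_in_imset _ _ f); last first.
  move=> X Y; rewrite !inE => /and3P[_ _ cX] /and3P[_ _ cY]; rewrite /f.
  (* A moved clique cannot land on a kept one: its image would be a clique of [e], and [both] would
     let it survive. *)
  have np Z : clique e Z -> ~~ clique e' Z -> ~~ clique e (p @: Z).
    by move=> cZ; apply: contra; exact: both.
  case: ifPn => hX; case: ifPn => hY // XY.
  - by case/negP: (np _ cY hY); rewrite -XY.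
  - by case/negP: (np _ cX hX); rewrite XY.
  - by rewrite -[X]pp XY pp.
apply/subset_leq_card/subsetP => _ /imsetP[X + ->]; rewrite !inE /f.
move=> /and3P[XS cX hX]; case: ifPn => h'; first by rewrite XS cX.
by rewrite pS // card_imset ?cX ?moved //; exact: perm_inj.
Qed.

Lemma leq_cocliques_shift e S k u v : symmetric e -> u \in S -> v \in S ->
  #|cliques (co_rel e) S k| <= #|cliques (co_rel (shift e u v)) S k|.
Proof.
move=> es uS vS; rewrite (eq_cliques _ _ (co_shift u v es)).
exact: leq_cliques_shift.
Qed.

(* Shifting towards [v] as long as its degree grows makes the neighbourhood of
   [v] contain every other one; a non-neighbour of [v] is then isolated. *)
Lemma exists_dominating_or_isolated e S v :
  symmetric e -> irreflexive e -> v \in S ->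
  exists e', [/\ symmetric e', irreflexive e',
    forall k, #|cliques e S k| <= #|cliques e' S k|,
    forall k, #|cliques (co_rel e) S k| <= #|cliques (co_rel e') S k| &
    exists2 w, w \in S & {in S, forall x, x != w -> e' w x} \/
                         {in S, forall x, x != w -> ~~ e' w x}].
Proof.
move=> es ei vS.
have [n] := ubnP #|[set x in S | ~~ e v x]|.
elim: n e es ei => // n IHn e es ei /ltnSE le_n.
have [/'exists_in_'exists_and4P[u uS [z [zS zv euz evz]]]|stable] :=
  boolP [exists u in S, exists z, [&& z \in S, z != v, e u z & ~~ e v z]].
  have uv : u != v by apply: contraNneq evz => <-.
  have zu : z != u by apply: contraTneq euz => ->; rewrite ei.
  have mono x : e v x -> shift e u v v x.
    by rewrite /shift eqxx => ->.
  have [|e' [es' ei' lec lec' dom]] :=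
    IHn (shift e u v) (shift_sym u v es) (shift_irr u v ei).
    apply: leq_trans le_n; apply: proper_card; apply/properP; split.
      apply/subsetP => x; rewrite !inE => /andP[-> /=].
      by apply: contra; exact: mono.
    exists z; rewrite !inE zS // negbK /shift eqxx /= tpermR tpermD 1?eq_sym //.
    by rewrite euz orbT.
  exists e'; split=> // k.
    exact: leq_trans (leq_cliques_shift e k uS vS) (lec k).
  exact: leq_trans (leq_cocliques_shift k es uS vS) (lec' k).
exists e; split=> //.
have {}stable u z : u \in S -> z \in S -> z != v -> e u z -> e v z.
  move=> uS zS zv euz; apply: contraNT stable => evz.
  by apply/'exists_in_'exists_and4P; exists u => //; exists z; split.
have [/'forall_in_implyP dom|] := boolP [forall x in S, (x != v) ==> e v x].
  by exists v => //; left.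
case/forall_inPn => w wS; rewrite negb_imply => /andP[wv nvw].
exists w => //; right => x xS xw; apply/negP => ewx.
by case/negP: nvw; apply: (stable x) => //; rewrite es.
Qed.

Lemma leq_cliquesD1 e S w k : w \in S ->
  #|cliques e S k.+1| <= #|cliques e (S :\ w) k.+1| + #|cliques e (S :\ w) k|.
Proof.
move=> wS; rewrite -(cardsID [set X : {set T} | w \in X]) addnC leq_add //.
  apply/subset_leq_card/subsetP => X; rewrite !inE => /andP[wX /and3P[XS -> ->]].
  by rewrite subsetD1 XS wX.
rewrite -(@card_in_imset _ _ (fun X => X :\ w)).
  apply/subset_leq_card/subsetP => _ /imsetP[X + ->]; rewrite !inE.
  move=> /andP[/and3P[XS /eqP cX /cliqueP hX] wX].
  rewrite setSD //= -eqSS -cX [in X in _ == X](cardsD1 w) wX eqxx /=.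
  by apply/cliqueP => x y /setD1P[_ ?] /setD1P[_ ?]; exact: hX.
move=> X Y; rewrite !inE => /andP[_ wX] /andP[_ wY] XY.
by rewrite -(setD1K wX) XY setD1K.
Qed.

(** No clique through [w] has a second vertex, so only the singleton is lost, and only at
    [k = 0]. *)
Lemma leq_cliques_isolated e S w k :
  {in S, forall x, x != w -> ~~ e w x} ->
  #|cliques e S k.+1| <= #|cliques e (S :\ w) k.+1| + (k == 0).
Proof.
move=> iso; rewrite -(cardsID [set X : {set T} | w \in X]) addnC leq_add //.
  apply/subset_leq_card/subsetP => X; rewrite !inE => /andP[wX /and3P[XS -> ->]].
  by rewrite subsetD1 XS wX.
have sub : cliques e S k.+1 :&: [set X : {set T} | w \in X] \subset
           if k == 0 then [set [set w]] else set0.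
  apply/subsetP => X; rewrite !inE => /andP[/and3P[/subsetP XS cX /cliqueP hX] wX].
  have Xw : X = [set w].
    apply/setP => x; rewrite !inE; apply/idP/eqP => [xX|->//].
    apply: contraTeq isT => xw; apply/negP => _.
    by have := iso x (XS x xX) xw; rewrite hX // eq_sym.
  by move: cX; rewrite Xw cards1 eqSS eq_sym => ->; rewrite inE.
apply: leq_trans (subset_leq_card sub) _.
by case: eqP; rewrite ?cards1 ?cards0.
Qed.

End Cliques.

(** Each set is counted at its last vertex in the order of [s]: a vertex of either kind, with [m]
    others among the [b] vertices of kind [c] before it. Kind [true] serves cliques, [false]
    edgeless sets. *)
Fixpoint path_binom (c : bool) (s : seq bool) (b m : nat) : nat :=
  if s is d :: s' then 'C(b, m) + path_binom c s' ((d == c) + b) m else 0.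

(** Pascal's rule for a vertex of kind [c] put in front of [s]: a set avoids it or uses it. *)
Lemma path_binomS c s b m :
  path_binom c s b.+1 m.+1 = path_binom c s b m.+1 + path_binom c s b m.
Proof.
elim: s b => //= d s IHs b; rewrite addnS IHs binS.
by rewrite -!addnA; congr (_ + _); rewrite addnCA.
Qed.

Lemma path_binom0 c s b : path_binom c s b 0 = size s.
Proof. by elim: s b => //= d s IHs b; rewrite bin0 IHs. Qed.

(* [s] records, in order of removal, whether a vertex was dominating; a clique
   then consists of a vertex and of dominating vertices removed before it. *)
Lemma cliques_le_path (T : finType) (e : rel T) (S : {set T}) :
  symmetric e -> irreflexive e ->
  exists2 s : seq bool, size s = #|S| &
    forall m, #|cliques e S m.+1| <= path_binom true s 0 m /\
              #|cliques (co_rel e) S m.+1| <= path_binom false s 0 m.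
Proof.
have [n] := ubnP #|S|; elim: n e S => // n IHn e S /ltnSE Sn es ei.
have [->|[v vS]] := set_0Vmem S.
  exists [::]; first by rewrite cards0.
  have no (e' : rel T) m : #|cliques e' set0 m.+1| = 0.
    apply: eq_card0 => X; rewrite !inE subset0.
    by apply/and3P => -[/eqP-> + _]; rewrite cards0.
  by move=> m; rewrite !no.
have [e' [es' ei' lec lec' [w wS dom]]] :=
  exists_dominating_or_isolated es ei vS.
have cw : #|S| = #|S :\ w|.+1 by rewrite (cardsD1 w) wS.
have [|s sz hs] := IHn e' (S :\ w) _ es' ei'; first by rewrite -cw.
have step (e1 : rel T) c : (forall m, #|cliques e1 (S :\ w) m.+1| <= path_binom c s 0 m) ->
    forall m, #|cliques e1 S m.+1| <= 'C(0, m) + path_binom c s 1 m.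
  move=> h m; apply: leq_trans (leq_cliquesD1 e1 m wS) _.
  (* For [m = 0] the sets of size [m] reduce to the empty set, matched by ['C(0, 0)]; otherwise the
     binomial vanishes and Pascal's rule remains. *)
  case: m => [|m]; last by rewrite bin0n add0n path_binomS leq_add ?h.
  rewrite addnC leq_add //; last by rewrite path_binom0 -(path_binom0 c s 0) h.
  rewrite bin0 -(cards1 (set0 : {set T})).
  apply/subset_leq_card/subsetP => X; rewrite !inE => /and3P[_ + _].
  by rewrite cards_eq0.
have stay (e1 : rel T) c : {in S, forall x, x != w -> ~~ e1 w x} ->
    (forall m, #|cliques e1 (S :\ w) m.+1| <= path_binom c s 0 m) ->
    forall m, #|cliques e1 S m.+1| <= 'C(0, m) + path_binom c s 0 m.
  move=> iso h m; apply: leq_trans (leq_cliques_isolated m iso) _.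
  by rewrite addnC leq_add // bin0n.
have [dw|iw] := dom.
  exists (true :: s); first by rewrite /= sz.
  move=> m; split; [apply: leq_trans (lec _) _|apply: leq_trans (lec' _) _].
    by rewrite /= addn0; apply: step => k; case: (hs k).
  apply: stay => [x xS xw|k]; last by case: (hs k).
  by rewrite /co_rel dw ?andbF.
exists (false :: s); first by rewrite /= sz.
move=> m; split; [apply: leq_trans (lec _) _|apply: leq_trans (lec' _) _].
  by apply: stay => // k; case: (hs k).
by rewrite /= addn0; apply: step => k; case: (hs k).
Qed.

(** * Induced copies as cliques of the graph or its complement *)

Lemma isomorphic_homogeneous (T : finType) (G : sgraph T) (X : {set T})
    (r : nat) (H : sgraph 'I_r) (b : bool) :
  (forall i j, adj H i j = (i != j) && b) ->
  isomorphic (induced G X) H <->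
  #|X| = r /\ {in X &, forall x y, x != y -> adj G x y = b}.
Proof.
move=> HE.
have cX : #|{: {x : T | x \in X}}| = #|X| by rewrite card_sig; apply: eq_card.
split=> [[f bf hf]|[cr hX]].
  split; first by rewrite -cX (bij_eq_card bf) card_ord.
  move=> x y xX yX xy; have := hf (exist _ x xX) (exist _ y yX).
  by rewrite HE adj_sgraph_of /= => <-; rewrite (inj_eq (bij_inj bf)) -val_eqE xy.
(* Adjacency off the diagonal is constant and equal on both sides, so any bijection is an
   isomorphism. *)
exists (fun x => cast_ord (etrans cX cr) (enum_rank x)).
  apply: bij_comp; last exact: enum_rank_bij.
  by exists (cast_ord (esym (etrans cX cr))); [exact: cast_ordK|exact: cast_ordKV].
move=> x y; rewrite HE adj_sgraph_of (inj_eq (@cast_ord_inj _ _ _)).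
rewrite (inj_eq enum_rank_inj); have [->|xy] := eqVneq x y; first by rewrite adj_irr.
by rewrite hX ?(valP x) ?(valP y) // val_eqE.
Qed.

Lemma isomorphic_complete (T : finType) (G : sgraph T) (X : {set T}) (r : nat) :
  isomorphic (induced G X) (complete r) <-> X \in cliques (adj G) [set: T] r.
Proof.
rewrite (@isomorphic_homogeneous _ _ _ _ _ true) => [|i j]; last first.
  by rewrite adj_sgraph_of andbT.
rewrite inE subsetT /=; split=> [[-> hX]|/andP[/eqP cX /cliqueP hX]].
  by rewrite eqxx; apply/cliqueP => x y xX yX /hX->.
by split=> // x y xX yX xy; rewrite hX.
Qed.

Lemma isomorphic_edgeless (T : finType) (G : sgraph T) (X : {set T}) (r : nat) :
  isomorphic (induced G X) (edgeless r) <->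
  X \in cliques (co_rel (adj G)) [set: T] r.
Proof.
rewrite (@isomorphic_homogeneous _ _ _ _ _ false) => [|i j]; last first.
  by rewrite adj_sgraph_of andbF.
rewrite inE subsetT /=; split=> [[-> hX]|/andP[/eqP cX /cliqueP hX]].
  by rewrite eqxx; apply/cliqueP => x y xX yX xy; rewrite /co_rel xy hX.
by split=> // x y xX yX xy; have /andP[_ /negbTE] := hX x y xX yX xy.
Qed.

Definition clique_count (T : finType) (e : rel T) (k : nat) : nat :=
  #|cliques e [set: T] k|.

(** * Lower bound: a clique with isolated vertices *)

Definition clique_rel (T : finType) (A : {set T}) : rel T :=
  fun x y => [&& x != y, x \in A & y \in A].

Fact clique_rel_irr (T : finType) (A : {set T}) : irreflexive (clique_rel A).
Proof. by move=> x; rewrite /clique_rel eqxx. Qed.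

Fact clique_rel_sym (T : finType) (A : {set T}) : symmetric (clique_rel A).
Proof. by move=> x y; rewrite /clique_rel eq_sym (andbC (x \in A)). Qed.

Lemma clique_rel_cliques (T : finType) (A : {set T}) (r : nat) :
  ('C(#|A|, r) <= clique_count (clique_rel A) r)%N.
Proof.
rewrite -cards_draws; apply/subset_leq_card/subsetP => X; rewrite !inE.
move=> /andP[/subsetP XA ->]; rewrite subsetT /=.
by apply/cliqueP => x y /XA xA /XA yA xy; apply/and3P.
Qed.

(** Two disjoint families of edgeless sets: those avoiding [A], and those with exactly one vertex in
    [A], which [F] parametrises injectively. *)
Lemma clique_rel_cocliques (T : finType) (A : {set T}) (m : nat) :
  ('C(#|~: A|, m.+1) + #|A| * 'C(#|~: A|, m) <=
   clique_count (co_rel (clique_rel A)) m.+1)%N.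
Proof.
set B := ~: A.
pose D k := [set X : {set T} | X \subset B & #|X| == k].
pose F (p : T * {set T}) := p.1 |: p.2.
have AB x (X : {set T}) : x \in A -> X \subset B -> x \notin X.
  by move=> xA /subsetP XB; apply/negP => /XB; rewrite inE xA.
have cF : #|F @: setX A (D m)| = (#|A| * 'C(#|B|, m))%N.
  rewrite card_in_imset ?cardsX ?cards_draws //.
  move=> [x X] [y Y] /setXP[/= xA]; rewrite inE => /andP[XB _].
  move=> /setXP[/= yA]; rewrite inE => /andP[YB _]; rewrite /F /= => XY.
  have xy : x = y.
    have : x \in y |: Y by rewrite -XY setU11.
    by rewrite !inE (negbTE (AB _ _ xA YB)) orbF => /eqP.
  subst y; congr (_, _).
  by rewrite -(setU1K (AB _ _ xA XB)) XY setU1K // AB.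
have dis : [disjoint D m.+1 & F @: setX A (D m)].
  rewrite -setI_eq0; apply/eqP/setP => X; rewrite !inE; apply/negP.
  move=> /andP[/andP[/subsetP XB _] /imsetP[[x Y] /setXP[/= xA _] XE]].
  by have := XB x; rewrite XE /F setU11 inE xA => /(_ isT).
rewrite -cF -cards_draws -[X in (X <= _)%N]cardsUI.
move: dis; rewrite -setI_eq0 => /eqP->; rewrite cards0 addn0.
apply/subset_leq_card/subsetP => X; rewrite inE => /orP[].
  rewrite !inE subsetT => /andP[/subsetP XB ->] /=.
  apply/cliqueP => x y /XB xB yX xy; rewrite /co_rel xy /clique_rel.
  by move: xB; rewrite inE => /negbTE->; rewrite andbF.
move=> /imsetP[[x Y] /setXP[/= xA]]; rewrite inE => /andP[YB /eqP cY] ->.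
rewrite !inE subsetT /F /= cardsU1 (AB _ _ xA YB) cY eqxx /=.
move/subsetP: YB => YB.
apply/cliqueP => y z; rewrite !inE /co_rel /clique_rel => yY zY yz; rewrite yz /=.
apply/negP => /andP[yA zA].
have no w : w \in A -> (w == x) || (w \in Y) -> w = x.
  by move=> wA /predU1P[//|/YB]; rewrite inE wA.
by move: yz; rewrite (no y) // (no z) // eqxx.
Qed.


Lemma exists_clique_graph (n k m : nat) : k <= n ->
  exists G : sgraph 'I_n,
    'C(k, m.+1) <= clique_count (adj G) m.+1 /\
    'C(n - k, m.+1) + k * 'C(n - k, m) <= clique_count (co_rel (adj G)) m.+1.
Proof.
move=> kn; pose A := [set i : 'I_n | i < k].
have cA : #|A| = k.
  rewrite -sum1dep_card (big_ord_narrow kn).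
  by rewrite sum1_card card_ord.
have cB : #|~: A| = n - k by rewrite cardsCs setCK card_ord cA.
exists (sgraph_of (@clique_rel_irr _ A) (@clique_rel_sym _ A)).
set e := adj _; have eE : e =2 clique_rel A by exact: adj_sgraph_of.
have eE' : co_rel e =2 co_rel (clique_rel A) by move=> x y; rewrite /co_rel eE.
rewrite /clique_count (eq_cliques _ _ eE) (eq_cliques _ _ eE').
have := clique_rel_cliques A m.+1; have := clique_rel_cocliques A m.
by rewrite cA cB => h1 h2; split.
Qed.

From mathcomp Require Import all_order all_algebra.
From mathcomp Require Import all_classical all_reals all_analysis.
From mathcomp Require Import ring lra.

Import Order.TTheory GRing.Theory Num.Theory.
Import numFieldNormedType.Exports.

Local Open Scope classical_set_scope.
Local Open Scope ring_scope.

(** * Quasiconvexity *)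

Lemma is_derive_horner (R : realType) (p : {poly R}) (x : R) :
  is_derive x 1 (horner p) p^`().[x].
Proof. by apply: DeriveDef; [exact: derivable_horner|rewrite derivE derive1E]. Qed.

(* [P / Q] is quasiconvex as soon as its derivative never passes from positive
   to negative values. *)
Lemma quasiconvex_ratio_le (R : realType) (P Q : {poly R}) (l u x : R) :
  (forall c, l <= c <= u -> 0 < Q.[c]) ->
  (forall c1 c2, l < c1 -> c1 < c2 -> c2 < u ->
    0 < (P^`() * Q - P * Q^`()).[c1] -> 0 <= (P^`() * Q - P * Q^`()).[c2]) ->
  l <= x <= u -> P.[l] <= Q.[l] -> P.[u] <= Q.[u] -> P.[x] <= Q.[x].
Proof.
move=> Q0 sgn /andP[lx xu] Pl Pu; rewrite leNgt; apply/negP => QP.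
pose f t := P.[t] / Q.[t].
pose W := P^`() * Q - P * Q^`().
have df c : l <= c <= u -> is_derive c 1 f (W.[c] / Q.[c] ^+ 2).
  move=> /Q0 Qc.
  have Qn0 : Q.[c] != 0 by rewrite gt_eqF.
  have dP := is_derive_horner P c.
  have dQ := is_deriveV Qn0 (is_derive_horner Q c).
  apply: (@is_derive_eq _ _ _ _ _ _ _ _ (is_deriveM dP dQ)).
  by rewrite /W !hornerE /GRing.scale /=; field.
have f1 c : l <= c <= u -> (f c <= 1) = (P.[c] <= Q.[c]).
  by move=> /Q0 Qc; rewrite /f ler_pdivrMr // mul1r.
have fx : 1 < f x by rewrite ltNge f1 ?lx // -ltNge.
have fl : f l <= 1 by rewrite f1 // lexx (le_trans lx xu).
have fu : f u <= 1 by rewrite f1 // lexx (le_trans lx xu).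
have mvt a b : l <= a -> a < b -> b <= u ->
    exists2 c, a < c < b & f b - f a = W.[c] / Q.[c] ^+ 2 * (b - a).
  move=> la ab bu.
  have sub c : c \in `[a, b] -> l <= c <= u.
    rewrite in_itv /= => /andP[ac cb].
    by rewrite (le_trans la ac) (le_trans cb bu).
  have [c cab ->] : exists2 c, c \in `]a, b[ &
      f b - f a = (fun c => W.[c] / Q.[c] ^+ 2) c * (b - a).
    apply: MVT => //.
      by move=> c cab; apply/df/sub; apply: subset_itv_oo_cc.
    by apply: derivable_within_continuous => c /sub /df dfc; apply: ex_derive.
  by exists c => //; move: cab; rewrite in_itv.
have lx' : l < x by rewrite lt_neqAle lx andbT; apply: contraTneq fx => <-; rewrite -leNgt.
have xu' : x < u by rewrite lt_neqAle xu andbT; apply: contraTneq fx => ->; rewrite -leNgt.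
(* Left of [x] the ratio rises above 1 and right of [x] it falls back, so its derivative, which has
   the sign of [W], is positive at [c1] and negative at [c2]. *)
have [c1 /andP[lc1 c1x] e1] := mvt l x (lexx _) lx' xu.
have [c2 /andP[xc2 c2u] e2] := mvt x u lx xu' (lexx _).
have Q2 c : l < c < u -> 0 < (Q.[c] ^+ 2)^-1.
  by move=> /andP[lc cu]; rewrite invr_gt0 exprn_gt0 // Q0 // !ltW.
have W1 : 0 < W.[c1].
  have : 0 < W.[c1] / Q.[c1] ^+ 2 * (x - l) by rewrite -e1 subr_gt0 (le_lt_trans fl).
  by rewrite pmulr_lgt0 ?subr_gt0 // pmulr_lgt0 // Q2 // lc1 (lt_trans c1x).
have : W.[c2] / Q.[c2] ^+ 2 * (u - x) < 0 by rewrite -e2 subr_lt0 (le_lt_trans fu).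
rewrite pmulr_llt0 ?subr_gt0 // pmulr_llt0; last by rewrite Q2 // c2u (lt_trans lx').
by rewrite ltNge (sgn c1) // (lt_trans c1x).
Qed.

(** The slope (t^n - 1) / (t - 1) is a geometric sum, nondecreasing for t >= 1; it is
    cross-multiplied to allow [a = 1]. *)
Lemma chord_expr (R : realDomainType) (n : nat) (a b : R) :
  1 <= a -> a <= b -> (a ^+ n - 1) * (b - 1) <= (b ^+ n - 1) * (a - 1).
Proof.
move=> a1 ab; rewrite !subrX1 mulrAC [leRHS]mulrAC (mulrC (b - 1)).
apply: ler_wpM2l; first by rewrite mulr_ge0 // subr_ge0 // (le_trans a1).
by apply: ler_sum => i _; rewrite lerXn2r // nnegrE (le_trans ler01) // (le_trans a1).
Qed.

(** By convexity: t^n - c is at most 0 at t = 1, so if it is below the line A (t - 1) at [b] it is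
    below it on [1, b]. This provides the sign condition in both uses of [quasiconvex_ratio_le]. *)
Lemma expr_le_chord (R : realFieldType) (n : nat) (a b c A : R) :
  1 <= c -> 1 <= a -> a <= b -> b ^+ n - c <= A * (b - 1) ->
  a ^+ n - c <= A * (a - 1).
Proof.
move=> c1 a1 ab hb.
have [b1|b1] := eqVneq b 1.
  have -> : a = 1 by apply/le_anti; rewrite a1 -b1 ab.
  by rewrite expr1n subrr mulr0 subr_le0.
have {}b1 : 0 < b - 1 by rewrite subr_gt0 lt_neqAle eq_sym b1 (le_trans a1).
rewrite -(ler_pM2r b1).
have h1 := chord_expr n a1 ab.
have h2 : (b ^+ n - c) * (a - 1) <= A * (b - 1) * (a - 1).
  by rewrite ler_wpM2r // subr_ge0.
have h3 : (c - 1) * (a - 1) <= (c - 1) * (b - 1).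
  by rewrite ler_wpM2l ?subr_ge0 // lerB.
lra.
Qed.

Lemma horner_deriv_exprS (R : comNzRingType) (p : {poly R}) (n : nat) (x : R) :
  (p ^+ n.+1)^`().[x] = n.+1%:R * p^`().[x] * p.[x] ^+ n.
Proof. by rewrite deriv_exp hornerMn hornerM horner_exp -mulr_natl mulrA. Qed.

(* [s => 1 - w / s <= (1 - c (w / s)^m)^m] is preserved when [s] grows; here
   [t] stands for [w / s]. *)
Lemma le_exprB_shrink (R : realType) (m : nat) (c t0 t : R) :
  (0 < m)%N -> 1 < c -> 0 <= t -> t <= t0 -> c * t0 ^+ m <= 1 ->
  1 - t0 <= (1 - c * t0 ^+ m) ^+ m -> 1 - t <= (1 - c * t ^+ m) ^+ m.
Proof.
case: m => // k _ c1 t_ge0 tt0 ct0 h0; set m := k.+1 in ct0 h0 *.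
have t0_ge0 : 0 <= t0 by apply: le_trans tt0.
have c0 : 0 < c by apply: lt_trans c1.
have t0_lt1 : t0 < 1.
  rewrite ltNge; apply/negP => t1.
  have : 1 <= t0 ^+ m by rewrite exprn_ege1.
  move=> h; have : c * 1 <= 1 by apply: le_trans ct0; rewrite ler_wpM2l // ltW.
  by rewrite mulr1 leNgt c1.
have ct0_lt1 : c * t0 ^+ m < 1.
  rewrite lt_neqAle ct0 andbT; apply/eqP => e.
  by move: h0; rewrite e subrr expr0n /= subr_le0 leNgt t0_lt1.
have w_lt1 s : 0 <= s <= t0 -> c * s ^+ m < 1.
  move=> /andP[s0 st0]; apply: le_lt_trans ct0_lt1.
  by rewrite ler_wpM2l ?(ltW c0) // lerXn2r.
(* [P = Q] at 0, and [P <= Q] at [t0] is the hypothesis, so quasiconvexity of [P / Q] between them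
   suffices. *)
pose P : {poly R} := 1 - 'X; pose Q : {poly R} := (1 - c *: 'X^m) ^+ m.
have PE s : P.[s] = 1 - s by rewrite !hornerE.
have QE s : Q.[s] = (1 - c * s ^+ m) ^+ m by rewrite !hornerE.
have WE s : (P^`() * Q - P * Q^`()).[s] =
    (1 - c * s ^+ m) ^+ k * (m%:R ^+ 2 * c * s ^+ k * (1 - s) - (1 - c * s ^+ m)).
  rewrite hornerD hornerN !hornerM horner_deriv_exprS PE QE /m.
  have -> : P^`().[s] = -1 by rewrite /P !poly.derivE sub0r hornerN hornerC.
  have -> : (1 - c *: 'X^(k.+1) : {poly R})^`().[s] = - (c * (k.+1%:R * s ^+ k)).
    rewrite !poly.derivE sub0r hornerN hornerZ hornerMn hornerXn.
    by rewrite -(mulr_natl (s ^+ k)).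
  have -> : (1 - c *: 'X^(k.+1) : {poly R}).[s] = 1 - c * s ^+ k.+1 by rewrite !hornerE.
  by rewrite exprS; ring.
rewrite -PE -QE; apply: (@quasiconvex_ratio_le _ P Q 0 t0).
- by move=> s s0; rewrite QE exprn_gt0 // subr_gt0 w_lt1.
- move=> t1 t2 t1_gt0 t12 t2t0; rewrite !WE.
  have t2_gt0 := lt_trans t1_gt0 t12.
  have w1 : 0 < 1 - c * t1 ^+ m by rewrite subr_gt0 w_lt1 // !ltW // (lt_trans t12).
  have w2 : 0 < 1 - c * t2 ^+ m by rewrite subr_gt0 w_lt1 // !ltW.
  rewrite pmulr_rgt0 ?exprn_gt0 // pmulr_rge0 ?exprn_gt0 //.
  (* In terms of a = 1 / s the sign is decided by comparing a^m - c with the line m^2 c (a - 1), and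
     a decreases as [s] grows. *)
  have eq s : 0 < s -> m%:R ^+ 2 * c * s ^+ k * (1 - s) - (1 - c * s ^+ m) =
      s ^+ m * (m%:R ^+ 2 * c * (s^-1 - 1) - (s^-1 ^+ m - c)).
    move=> s0; rewrite exprVn /m (exprS s).
    by field; rewrite ?expf_neq0 ?gt_eqF.
  rewrite !eq // pmulr_rgt0 ?exprn_gt0 // pmulr_rge0 ?exprn_gt0 //.
  rewrite subr_gt0 subr_ge0 => /ltW; apply: expr_le_chord; first exact: ltW.
    by rewrite invf_ge1 // ltW // (lt_trans t2t0).
  by rewrite lef_pV2 ?posrE // ltW.
- by rewrite t_ge0.
- by rewrite PE QE expr0n mulr0 !subr0 expr1n.
- by rewrite PE QE.
Qed.

Lemma horner_nondecreasing (R : realType) (p : {poly R}) (l u : R) :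
  (forall c, l <= c <= u -> 0 <= p^`().[c]) ->
  forall a b, l <= a -> a <= b -> b <= u -> p.[a] <= p.[b].
Proof.
move=> dp a b la; rewrite le_eqVlt => /predU1P[->//|ab] bu.
have [c] : exists2 c, c \in `]a, b[ & p.[b] - p.[a] = p^`().[c] * (b - a).
  apply: (@MVT _ (horner p) (horner p^`())) => //.
  by apply: continuous_subspaceT => x; exact: continuous_horner.
rewrite in_itv /= => /andP[ac cb] e; rewrite -subr_ge0 e mulr_ge0 ?subr_ge0 ?(ltW ab) //.
by rewrite dp // (le_trans la (ltW ac)) (le_trans (ltW cb)).
Qed.

(* The density of edgeless sets of size [m.+1] in the limit of a clique with a
   fraction [x] of isolated vertices. *)
Definition edgeless_limit (R : pzRingType) (m : nat) (x : R) : R :=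
  x ^+ m.+1 + m.+1%:R * x ^+ m * (1 - x).

(** The derivative is (m + 1) m x^(m-1) (1 - x). *)
Lemma edgeless_limit_le (R : realType) (m : nat) (a b : R) :
  (0 < m)%N -> 0 <= a -> a <= b -> b <= 1 -> edgeless_limit m a <= edgeless_limit m b.
Proof.
case: m => // k _.
pose p : {poly R} := 'X^(k.+2) + k.+2%:R *: 'X^(k.+1) * (1 - 'X).
have pE x : p.[x] = edgeless_limit k.+1 x by rewrite !hornerE.
rewrite -!pE; apply: horner_nondecreasing => c /andP[c0 c1].
have -> : p^`().[c] = k.+2%:R * k.+1%:R * c ^+ k * (1 - c).
  rewrite /p derivD -scalerAl derivZ (derivM 'X^(k.+1)) !hornerD hornerZ hornerD !hornerM.
  rewrite !horner_deriv_exprS derivB derivX derivC hornerXn hornerX !hornerE.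
  by rewrite -!natr1 (exprS c); ring.
by rewrite !mulr_ge0 ?ler0n ?exprn_ge0 ?subr_ge0.
Qed.

(** * Three-block paths *)

(* With [s = rho / x], [y = alpha s - 1 - (s^r - 1) / r] and [alpha = 1 / rho],
   this bounds the three-block configurations whose first density is exactly
   [rho^r]; both end points of the range of [s] are extremal. *)
Lemma three_block_curve_le (R : realType) (m : nat) (alpha z s : R) :
  let r := m.+1%:R in (0 < m)%N -> 1 < alpha ->
  (alpha - 1) ^+ m.+1 + r * (alpha - 1) ^+ m = 1 ->
  alpha * z - 1 = z -> z ^+ m.+1 - 1 = r * z -> 1 <= s <= z ->
  (alpha * s - 1) ^+ m.+1 + r * (alpha * s - 1 - (s ^+ m.+1 - 1) / r) ^+ m
    <= s ^+ m.+1.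
Proof.
case: m => // k r _ alpha1 end1 endz zr s1z; set m := k.+1 in r end1 zr *.
have r0 : 0 < r by rewrite ltr0n.
pose Y : {poly R} := alpha *: 'X - 1 - r^-1 *: ('X^(m.+1) - 1).
pose P : {poly R} := (alpha *: 'X - 1) ^+ m.+1 + r *: Y ^+ m.
pose Q : {poly R} := 'X^(m.+1).
(* In units of the middle block [x], with [s = rho / x]: [q] is the total length of the outer
   blocks, [zz] the last block when the first density is exactly [rho^r], and [y] the remaining
   one. *)
pose q t := alpha * t - 1; pose zz t := (t ^+ m.+1 - 1) / r; pose y t := q t - zz t.
have PE t : P.[t] = q t ^+ m.+1 + r * y t ^+ m.
  by rewrite /P /Y !hornerE /y /q /zz (mulrC r^-1).
have QE t : Q.[t] = t ^+ m.+1 by rewrite !hornerE.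
have WE t : (P^`() * Q - P * Q^`()).[t] =
    r * t ^+ m * (q t ^+ m - y t ^+ m - m%:R ^+ 2 * y t ^+ k * zz t).
  have YE : Y.[t] = y t by rewrite /Y !hornerE /y /q /zz (mulrC r^-1).
  have dY : Y^`().[t] = alpha - t ^+ m.
    rewrite /Y !derivB !derivZ !derivB derivX !derivC !hornerD !hornerN !hornerZ.
    rewrite hornerD hornerN horner_deriv_exprS derivX !hornerC hornerX !subr0 !mulr1.
    by rewrite mulKf ?gt_eqF.
  have dP : P^`().[t] = r * (alpha * q t ^+ m + m%:R * y t ^+ k * (alpha - t ^+ m)).
    rewrite /P derivD derivZ hornerD hornerZ !horner_deriv_exprS YE dY.
    rewrite derivB derivZ derivX derivC !hornerE /= /q -/m -/r; ring.
  have tz : t * t ^+ m = 1 + r * zz t.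
    by rewrite /zz mulrCA divff ?mulr1 -?exprS ?gt_eqF //; ring.
  have yz : y t = q t - zz t by [].
  have qt : alpha * t = 1 + q t by rewrite /q; ring.
  rewrite hornerD hornerN hornerM (hornerM P) dP PE QE.
  rewrite /Q horner_deriv_exprS derivX hornerX hornerC -/r.
  move: (zz t) (y t) (q t) tz yz qt => Z Y' Q' tz yz qt.
  rewrite (exprS Q' m) (exprS t m) (exprS Y' k).
  have rm : r = m%:R + 1 by rewrite /r -natr1.
  transitivity (r * t ^+ m * ((alpha * t) * Q' ^+ m +
      m%:R * Y' ^+ k * (alpha * t - t * t ^+ m) -
      (Q' * Q' ^+ m + r * (Y' * Y' ^+ k)))); first by ring.
  by rewrite tz qt rm (_ : Z = Q' - Y'); [ring|rewrite yz; ring].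
rewrite -/(q s) -/(zz s) -/(y s) -PE -QE.
have z1 : 1 <= z by case/andP: s1z => /le_trans h /h.
have qpos t : 1 <= t -> 0 < q t.
  move=> t1; rewrite subr_gt0 (lt_le_trans alpha1) //.
  by rewrite -[leLHS]mulr1 ler_wpM2l // ltW // (lt_trans _ alpha1).
(* [zz / q] strictly increases: in q = alpha (t - 1) + (alpha - 1) the first part is handled by
   chords and the second by the growth of t^r. Hence [y > 0] before [z], where [zz = q], and [q / y]
   increases. *)
have cross a b : 1 <= a -> a < b -> q b * zz a < q a * zz b.
  move=> a1 ab.
  have h := chord_expr m.+1 a1 (ltW ab).
  have h2 : a ^+ m.+1 < b ^+ m.+1.
    by rewrite ltrXn2r // (le_trans ler01).
  rewrite /zz !mulrA ltr_pM2r ?invr_gt0 //.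
  have h3 : alpha * ((a ^+ m.+1 - 1) * (b - 1)) <= alpha * ((b ^+ m.+1 - 1) * (a - 1)).
    by rewrite ler_wpM2l // ltW // (lt_trans _ alpha1).
  have h4 : (alpha - 1) * (a ^+ m.+1 - 1) < (alpha - 1) * (b ^+ m.+1 - 1).
    by rewrite ltr_pM2l ?subr_gt0 // ltrD2r.
  rewrite /q; lra.
have zzz : zz z = q z by rewrite /zz zr mulrC mulKf ?gt_eqF.
have ypos t : 1 <= t -> t < z -> 0 < y t.
  move=> t1 tz; rewrite subr_gt0 -(ltr_pM2l (qpos z z1)).
  by rewrite [ltRHS]mulrC -[in ltRHS]zzz cross.
have zpos t : 1 <= t -> 0 <= zz t.
  by move=> t1; rewrite divr_ge0 ?ler0n // subr_ge0 exprn_ege1.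
apply: (@quasiconvex_ratio_le _ P Q 1 z) => //.
- by move=> t /andP[t1 _]; rewrite QE exprn_gt0 // (lt_le_trans ltr01).
- move=> a b a1 ab bz; rewrite !WE.
  have b1 := lt_trans a1 ab; have az := lt_trans ab bz.
  have ya := ypos a (ltW a1) az; have yb := ypos b (ltW b1) bz.
  have pr t : 1 < t -> 0 < r * t ^+ m.
    by move=> t1; rewrite mulr_gt0 // exprn_gt0 // (lt_trans ltr01).
  rewrite pmulr_rgt0 ?pmulr_rge0 ?pr //.
  (* The derivative has the sign of a^m - 1 - m^2 (a - 1) at a = q / y, which by [expr_le_chord]
     cannot pass from positive to negative as a grows. *)
  have eq t : 0 < y t -> q t ^+ m - y t ^+ m - m%:R ^+ 2 * y t ^+ k * zz t =
      y t ^+ m * ((q t / y t) ^+ m - 1 - m%:R ^+ 2 * (q t / y t - 1)).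
    move=> yt; have -> : zz t = q t - y t by rewrite /y; ring.
    rewrite expr_div_n !(exprS _ k).
    by field; rewrite ?expf_neq0 ?gt_eqF.
  rewrite !eq // pmulr_rgt0 ?exprn_gt0 // pmulr_rge0 ?exprn_gt0 //.
  rewrite subr_gt0 subr_ge0 => h; rewrite leNgt; apply/negP => h'.
  move: h; rewrite ltNge => /negP; apply.
  apply: expr_le_chord (ltW h') => //.
    by rewrite ler_pdivlMr // mul1r lerBlDr lerDl zpos // ltW.
  rewrite ler_pdivrMr // mulrAC ler_pdivlMr //.
  have := cross a b (ltW a1) ab; rewrite /y; lra.
- rewrite PE QE /y /zz /q !expr1n subrr mul0r subr0 !mulr1.
  by rewrite end1.
- by rewrite PE QE /y zzz subrr expr0n mulr0 addr0 /q endz.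
Qed.

(** If [x >= rho], the second density is bounded by [edgeless_limit] at [1 - x]; if [x <= 1 - rho],
    the first cannot exceed rho^r. In between, comparison with the path of the same [x] whose first
    density is exactly rho^r leads to [three_block_curve_le]. *)
Lemma three_block_lt (R : realType) (m : nat) (rho x y z : R) :
  (0 < m)%N -> 0 < rho < 1 -> rho ^+ m.+1 = edgeless_limit m (1 - rho) ->
  0 <= x -> 0 <= y -> 0 <= z -> x + y + z = 1 ->
  rho ^+ m.+1 < x ^+ m.+1 + m.+1%:R * x ^+ m * z ->
  (y + z) ^+ m.+1 + m.+1%:R * x * y ^+ m <= rho ^+ m.+1.
Proof.
move=> m0 /andP[rho0 rho1] e x0 y0 z0 T F1.
have xyz : y + z = 1 - x by lra.
have x1 : x <= 1 by lra.
have r0 : 0 < m.+1%:R :> R by rewrite ltr0n.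
have [rx|xr] := leP rho x.
  apply: (@le_trans _ _ (edgeless_limit m (1 - x))); last first.
    by rewrite e edgeless_limit_le //; lra.
  rewrite /edgeless_limit -xyz lerD2l (_ : 1 - (y + z) = x); last by lra.
  by rewrite mulrAC ler_wpM2r // ler_wpM2l ?ler0n // lerXn2r ?nnegrE //; lra.
have xr' : 1 - rho < x.
  rewrite ltNge; apply/negP => h; move: F1; rewrite ltNge => /negP; apply.
  rewrite e; apply: (@le_trans _ _ (edgeless_limit m x)); last first.
    by rewrite edgeless_limit_le //; lra.
  by rewrite /edgeless_limit lerD2l ler_wpM2l ?mulr_ge0 ?ler0n ?exprn_ge0 //; lra.
have xp : 0 < x by lra.
pose s := rho / x; pose r : R := m.+1%:R.
have rr : 0 < 1 - rho by lra.
have h : (rho^-1 * s - 1) ^+ m.+1 +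
    r * (rho^-1 * s - 1 - (s ^+ m.+1 - 1) / r) ^+ m <= s ^+ m.+1.
  (* The ends of the range of [s] are [x = rho] and [x = 1 - rho]; the critical equation gives
     equality at both. *)
  apply: (@three_block_curve_le R m rho^-1 (rho / (1 - rho)) s m0).
  - by rewrite invf_gt1.
  - have -> : rho^-1 - 1 = (1 - rho) / rho by field; rewrite gt_eqF.
    rewrite !expr_div_n; apply: (mulfI (expf_neq0 m.+1 (lt0r_neq0 rho0))).
    rewrite mulr1 [RHS]e /edgeless_limit -/r !exprS; field.
    by rewrite ?expf_neq0 gt_eqF.
  - by field; rewrite !gt_eqF.
  - rewrite expr_div_n; apply: (mulfI (expf_neq0 m.+1 (lt0r_neq0 rr))).
    rewrite mulrBr mulrCA divff ?expf_neq0 ?gt_eqF // !mulr1 e /edgeless_limit -/r !exprS.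
    by field; rewrite gt_eqF.
  - rewrite /s ler_pdivlMr // mul1r (ltW xr) /=.
    by rewrite ler_pM2l // lef_pV2 ?posrE // ltW.
have h2 : (1 - x) ^+ m.+1 + r * x * (x * (rho^-1 * s - 1 - (s ^+ m.+1 - 1) / r)) ^+ m
   <= rho ^+ m.+1.
  have -> : rho ^+ m.+1 = x ^+ m.+1 * s ^+ m.+1.
    by rewrite -exprMn /s mulrC divfK ?gt_eqF.
  have -> : 1 - x = x * (rho^-1 * s - 1) by rewrite /s; field; rewrite !gt_eqF.
  apply: le_trans (ler_wpM2l (exprn_ge0 m.+1 x0) h).
  rewrite !exprMn mulrDr lerD2l (exprS x m) -/r le_eqVlt.
  by apply/predU1P; left; ring.
(* For fixed [x] the first density grows with [z], so [z] is at least its value on the curve and [y]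
   at most, as [y + z] is fixed. *)
have hz : (rho ^+ m.+1 / x ^+ m - x) / r <= z.
  rewrite ler_pdivrMr // lerBlDr ler_pdivrMr ?exprn_gt0 //; apply: ltW.
  apply: lt_le_trans F1 _; rewrite -/r exprS le_eqVlt; apply/predU1P; left; ring.
have yw : y <= x * (rho^-1 * s - 1 - (s ^+ m.+1 - 1) / r).
  suff -> : x * (rho^-1 * s - 1 - (s ^+ m.+1 - 1) / r) =
    1 - x - (rho ^+ m.+1 / x ^+ m - x) / r by move: (_ / r) hz => c; lra.
  rewrite /s expr_div_n (exprS x); field.
  by rewrite !gt_eqF ?exprn_gt0.
apply: le_trans h2; rewrite xyz lerD2l ler_wpM2l ?mulr_ge0 ?ler0n //.
by rewrite lerXn2r ?nnegrE // (le_trans y0).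
Qed.

(** * Lattice paths *)

(* For [X > 0] this reads [v <= X y^m] with [y = Y - u / X^m]: among the
   paths with these values of [X], [Y] and [u], the one made of three blocks
   [y], [X], [Y - y] has a larger [v]. *)
Definition three_block_bound (R : numDomainType) (m : nat) (X Y u v : R) : Prop :=
  v * X ^+ (m * m) <= X * (X ^+ m * Y - u) ^+ m.

(* [u] and [v] are the sums of [X^m] over the steps increasing [Y] and of [Y^m]
   over the steps increasing [X] in a lattice path from the origin to [(X, Y)]. *)
Definition path_state (R : numDomainType) (m : nat) (X Y u v : R) : Prop :=
  [/\ 0 <= X /\ 0 <= Y, 0 <= u <= X ^+ m * Y, 0 <= v <= Y ^+ m * X &
      three_block_bound m X Y u v \/ three_block_bound m Y X v u].

Lemma path_state_sym (R : numDomainType) (m : nat) (X Y u v : R) :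
  path_state m X Y u v -> path_state m Y X v u.
Proof. by case=> -[X0 Y0] u0 v0 h; split => //; case: h; [right|left]. Qed.

(** Normalised form: [u] and [v] are measured against X^m Y and Y^m X, their largest values in a
    path state. *)
Lemma three_block_boundE (R : realFieldType) (m : nat) (X Y u v : R) :
  0 < X -> 0 < Y -> three_block_bound m X Y u v <->
  v / (Y ^+ m * X) <= (1 - u / Y / X ^+ m) ^+ m.
Proof.
move=> X0 Y0; rewrite /three_block_bound.
have -> : 1 - u / Y / X ^+ m = (X ^+ m * Y - u) / (X ^+ m * Y).
  by field; rewrite ?expf_neq0 gt_eqF.
rewrite expr_div_n exprMn -exprM ler_pdivrMr ?mulr_gt0 ?exprn_gt0 //.
have -> : (X ^+ m * Y - u) ^+ m / (X ^+ (m * m) * Y ^+ m) * (Y ^+ m * X) =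
    X * (X ^+ m * Y - u) ^+ m / X ^+ (m * m).
  by field; rewrite ?expf_neq0 ?gt_eqF ?exprn_gt0.
by rewrite ler_pdivlMr ?exprn_gt0.
Qed.

(** The step leaves w = X - v / Y^m unchanged. For w > 0, with t = w / X and c = u / (Y w^m), the
    bound reads 1 - t <= (1 - c t^m)^m, and t shrinks as [X] grows; c > 1 is exactly the failure of
    the mirror bound. *)
Lemma three_block_bound_step (R : realType) (m : nat) (X Y u v h : R) :
  (0 < m)%N -> 0 <= X -> 0 <= Y -> 0 <= u <= X ^+ m * Y -> 0 <= v <= Y ^+ m * X ->
  0 <= h -> three_block_bound m X Y u v -> ~ three_block_bound m Y X v u ->
  three_block_bound m (X + h) Y u (v + h * Y ^+ m).
Proof.
move=> m0 X_ge0 Y_ge0 /andP[u_ge0 uXY] /andP[v_ge0 vXY] h0 P nQ.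
(* The mirror bound holds for [u = 0], so its failure makes [u], [X] and [Y] positive. *)
have triv : u = 0 -> three_block_bound m Y X v u.
  move=> ->; rewrite /three_block_bound mul0r mulr_ge0 // exprn_ge0 //.
  by rewrite subr_ge0.
have u0 : 0 < u by rewrite lt_neqAle eq_sym u_ge0 andbT; apply/eqP => /triv.
have XY0 := lt_le_trans u0 uXY.
have X0 : 0 < X.
  rewrite lt_neqAle eq_sym X_ge0 andbT; apply: contraTneq XY0 => ->.
  by rewrite expr0n gtn_eqF // mul0r ltxx.
have Y0 : 0 < Y.
  rewrite lt_neqAle eq_sym Y_ge0 andbT; apply: contraTneq XY0 => ->.
  by rewrite mulr0 ltxx.
have Xh0 : 0 < X + h by rewrite ltr_wpDr.
pose w := (Y ^+ m * X - v) / Y ^+ m; pose q := u / Y.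
have Ym0 : 0 < Y ^+ m by rewrite exprn_gt0.
have w0 : 0 <= w by rewrite divr_ge0 ?(ltW Ym0) // subr_ge0.
have q0 : 0 < q by rewrite divr_gt0.
have E t : 0 < t -> (v + (t - X) * Y ^+ m) / (Y ^+ m * t) = 1 - w / t.
  by move=> t0; rewrite /w; field; rewrite !gt_eqF.
apply/(three_block_boundE m u _ Xh0 Y0).
rewrite (_ : h = (X + h) - X); last by ring.
rewrite [X in X <= _](_ : _ = (v + ((X + h) - X) * Y ^+ m) / (Y ^+ m * (X + h))); last first.
  by congr (_ / (_ * _)); ring.
rewrite E //; set X' := X + (X + h - X).
have -> : X' = X + h by rewrite /X'; ring.
rewrite -/q; move/(three_block_boundE m u _ X0 Y0): P; rewrite -/q.
have -> : v / (Y ^+ m * X) = 1 - w / X.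
  by rewrite -E // subrr mul0r addr0.
move=> P.
have wq : w ^+ m < q.
  move: nQ; rewrite (three_block_boundE m v u Y0 X0) => /negP; rewrite -ltNge.
  have -> : 1 - v / X / Y ^+ m = w / X by rewrite /w; field; rewrite !gt_eqF.
  have -> : u / (X ^+ m * Y) = q / X ^+ m.
    by rewrite /q; field; rewrite ?expf_neq0 ?gt_eqF ?exprn_gt0.
  by rewrite expr_div_n ltr_pM2r // invr_gt0 exprn_gt0.
have qX : q <= X ^+ m by rewrite ler_pdivrMr.
(* For [w = 0] the bound would read 1 <= (1 - q / X^m)^m, impossible as q > 0. *)
have [w00|wn0] := eqVneq w 0.
  move: P; rewrite w00 mul0r subr0 leNgt exprn_ilt1 ?(lt0n_neq0 m0) //.
  - by rewrite subr_ge0 ler_pdivrMr ?exprn_gt0 // mul1r.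
  - by rewrite ltrBlDr ltrDl divr_gt0 ?exprn_gt0.
have {}w0 : 0 < w by rewrite lt_neqAle eq_sym wn0.
have cE t : 0 < t -> q / w ^+ m * (w / t) ^+ m = q / t ^+ m.
  by move=> t0; rewrite (expr_div_n w t) mulrA divfK ?gt_eqF ?exprn_gt0.
rewrite -cE //; apply: (@le_exprB_shrink R m _ (w / X)) => //.
- by rewrite ltr_pdivlMr ?mul1r ?exprn_gt0.
- by rewrite divr_ge0 ?ltW.
- by rewrite ler_pM2l // lef_pV2 ?posrE // lerDl.
- by rewrite cE // ler_pdivrMr ?exprn_gt0 // mul1r.
- by rewrite cE.
Qed.

(** The mirror bound is preserved outright, because [Y^m X - v] does not change; if it fails,
    [three_block_bound_step] applies. *)
Lemma path_state_step (R : realType) (m : nat) (X Y u v : R) :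
  (0 < m)%N -> path_state m X Y u v ->
  path_state m (X + 1) Y u (v + Y ^+ m).
Proof.
move=> m0 [[X0 Y0] uXY vXY PQ].
have /andP[u0 uX] := uXY; have /andP[v0 vX] := vXY.
split.
- by rewrite addr_ge0.
- rewrite u0 (le_trans uX) // ler_wpM2r // lerXn2r ?nnegrE ?addr_ge0 //.
  by rewrite lerDl.
- by rewrite addr_ge0 ?exprn_ge0 //= mulrDr mulr1 lerD2r.
have [Q|nQ] := pselect (three_block_bound m Y X v u).
  right; move: Q; rewrite /three_block_bound.
  by rewrite mulrDr mulr1 opprD addrACA subrr addr0.
left; case: PQ => // P; rewrite -[Y ^+ m]mul1r.
exact: three_block_bound_step.
Qed.

Lemma ffact_le_exp (n m : nat) : (n ^_ m <= n ^ m)%N.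
Proof.
by elim: m => // m IHm; rewrite ffactnSr expnSr leq_mul // leq_subr.
Qed.

Lemma fact_bin_le (R : numDomainType) (n m : nat) :
  (m.+1)`!%:R * 'C(n, m)%:R <= m.+1%:R * n%:R ^+ m :> R.
Proof.
rewrite factS natrM -mulrA ler_wpM2l // -natrM mulnC bin_ffact -natrX ler_nat.
exact: ffact_le_exp.
Qed.

(** The first two terms of the binomial expansion. With [fact_bin_le], it lets the continuous
    quantities dominate the counts step by step, without error terms. *)
Lemma exprD1_ge (R : numDomainType) (m : nat) (x : R) : 0 <= x ->
  x ^+ m.+1 + m.+1%:R * x ^+ m <= (x + 1) ^+ m.+1.
Proof.
move=> x0; elim: m => [|m IHm]; first by rewrite !expr1 expr0 mulr1.
rewrite [leRHS]exprS; apply: le_trans (ler_wpM2l (addr_ge0 x0 ler01) IHm).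
rewrite -subr_ge0 (_ : _ - _ = m.+1%:R * x ^+ m); last first.
  by rewrite -(natr1 m.+1) !(exprS x); ring.
by rewrite mulr_ge0 ?exprn_ge0.
Qed.

(** With r = m + 1, each entry adds to X^r + r u and Y^r + r v at least r! times what it adds to the
    counts. [a] and [b] number the [false] entries (X-steps) and [true] entries (Y-steps) already
    read. *)
Lemma path_binom_le (R : realType) (m : nat) (s : seq bool) (a b : nat) (u v : R) :
  (0 < m)%N -> path_state m a%:R b%:R u v ->
  exists X Y u' v', [/\ path_state m X Y u' v', X + Y = (a + b + size s)%:R,
    m.+1`!%:R * (path_binom false s a m)%:R + (a%:R ^+ m.+1 + m.+1%:R * u)
      <= X ^+ m.+1 + m.+1%:R * u' &
    m.+1`!%:R * (path_binom true s b m)%:R + (b%:R ^+ m.+1 + m.+1%:R * v)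
      <= Y ^+ m.+1 + m.+1%:R * v'].
Proof.
move=> m0; elim: s a b u v => [|d s IHs] a b u v st.
  exists a%:R, b%:R, u, v; split=> //=; rewrite ?mulr0 ?add0r //.
  by rewrite addn0 natrD.
have Ca := fact_bin_le R a m; have Cb := fact_bin_le R b m.
case: d.
  have st' : path_state m a%:R b.+1%:R (u + a%:R ^+ m) v.
    by rewrite -natr1; apply/path_state_sym/path_state_step/path_state_sym.
  have [X [Y [u' [v' [h1 h2 h3 h4]]]]] := IHs _ _ _ _ st'.
  exists X, Y, u', v'; split => //; first by rewrite h2 /= addnS addSnnS addnS.
    by apply: le_trans h3; rewrite /= natrD; lra.
  apply: le_trans h4; rewrite /= add1n natrD -(natr1 b).
  have := exprD1_ge m (ler0n R b); lra.
have st' : path_state m a.+1%:R b%:R u (v + b%:R ^+ m).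
  by rewrite -natr1; apply: path_state_step.
have [X [Y [u' [v' [h1 h2 h3 h4]]]]] := IHs _ _ _ _ st'.
exists X, Y, u', v'; split => //; first by rewrite h2 /= addSn addnS.
  apply: le_trans h3; rewrite /= add1n natrD -(natr1 a).
  have := exprD1_ge m (ler0n R a); lra.
by apply: le_trans h4; rewrite /= natrD; lra.
Qed.

(** By homogeneity: dividing by [n = X + Y] and setting z = u / X^m, y = Y - z reduces to the
    three-block path with blocks y, X, z. *)
Lemma three_block_bound_le (R : realType) (m : nat) (rho X Y u v : R) :
  (0 < m)%N -> 0 < rho < 1 -> rho ^+ m.+1 = edgeless_limit m (1 - rho) ->
  0 <= X -> 0 <= Y -> 0 <= u <= X ^+ m * Y -> 
  three_block_bound m X Y u v ->
  (rho * (X + Y)) ^+ m.+1 < X ^+ m.+1 + m.+1%:R * u ->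
  Y ^+ m.+1 + m.+1%:R * v <= (rho * (X + Y)) ^+ m.+1.
Proof.
move=> m0 rho01 e X0 Y0 /andP[u0 uXY] P F1.
have [rho0 rho1] := andP rho01.
have Xp : 0 < X.
  rewrite lt_neqAle eq_sym X0 andbT; apply: contraTneq F1 => X00.
  have -> : u = 0.
    by apply/le_anti; rewrite u0 andbT; move: uXY; rewrite X00 expr0n gtn_eqF // mul0r.
  by rewrite X00 expr0n mulr0 addr0 -leNgt exprn_ge0 // add0r mulr_ge0 // ltW.
set n := X + Y in F1 *.
have np : 0 < n by rewrite ltr_wpDr.
have Xm : 0 < X ^+ m by rewrite exprn_gt0.
pose z := u / X ^+ m; pose y := Y - z.
have uE : u = X ^+ m * z by rewrite /z mulrC divfK ?gt_eqF.
have z0 : 0 <= z by rewrite divr_ge0 ?(ltW Xm).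
have y0 : 0 <= y by rewrite subr_ge0 ler_pdivrMr // mulrC.
have vy : v <= X * y ^+ m.
  move: P; rewrite /three_block_bound uE -mulrBr -/y exprMn -exprM mulrCA.
  by rewrite mulrC ler_pM2l ?exprn_gt0.
have := @three_block_lt R m rho (X / n) (y / n) (z / n) m0 rho01 e.
rewrite !divr_ge0 ?(ltW np) ?(ltW Xm) //.
have -> : X / n + y / n + z / n = 1.
  by rewrite -!mulrDl /y -addrA subrK divff ?gt_eqF.
move=> /(_ isT isT isT erefl).
have nn : 0 < n ^+ m.+1 by rewrite exprn_gt0.
have -> : (X / n) ^+ m.+1 + m.+1%:R * (X / n) ^+ m * (z / n) =
   (X ^+ m.+1 + m.+1%:R * u) / n ^+ m.+1.
  rewrite uE !expr_div_n !(exprS n); field.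
  by rewrite ?expf_neq0 gt_eqF.
rewrite ltr_pdivlMr // -exprMn => /(_ F1) h.
apply: (@le_trans _ _ (Y ^+ m.+1 + m.+1%:R * X * y ^+ m)).
  by rewrite lerD2l -mulrA ler_wpM2l.
rewrite exprMn -ler_pdivrMr //; apply: le_trans h.
have -> : y / n + z / n = Y / n by rewrite -mulrDl subrK.
rewrite !expr_div_n !(exprS n) le_eqVlt; apply/predU1P; left; field.
by rewrite ?expf_neq0 gt_eqF.
Qed.

Lemma path_binom_min_le (R : realType) (m : nat) (rho : R) (s : seq bool) :
  (0 < m)%N -> 0 < rho < 1 -> rho ^+ m.+1 = edgeless_limit m (1 - rho) ->
  m.+1`!%:R * (path_binom false s 0 m)%:R <= (rho * (size s)%:R) ^+ m.+1 \/
  m.+1`!%:R * (path_binom true s 0 m)%:R <= (rho * (size s)%:R) ^+ m.+1.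
Proof.
move=> m0 rho01 e.
have st : path_state m (0%:R : R) 0%:R 0 0.
  by split; rewrite ?mulr0 ?lexx //; left; rewrite /three_block_bound !mul0r.
have [X [Y [u [v [[[X0 Y0] u0 v0 PQ] XY]]]]] := path_binom_le s m0 st.
rewrite expr0n mulr0 !addr0 => h1 h2.
rewrite !add0n in XY; rewrite -XY.
have [F1|F1] := leP (X ^+ m.+1 + m.+1%:R * u) ((rho * (X + Y)) ^+ m.+1).
  by left; apply: le_trans F1.
have [F2|F2] := leP (Y ^+ m.+1 + m.+1%:R * v) ((rho * (X + Y)) ^+ m.+1).
  by right; apply: le_trans F2.
case: PQ => [P|Q].
  by move: F2; rewrite ltNge (three_block_bound_le m0 rho01 e X0 Y0 u0 P F1).
rewrite addrC in F1 F2.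
by move: F1; rewrite ltNge (three_block_bound_le m0 rho01 e Y0 X0 v0 Q F2).
Qed.

(** * Asymptotics *)

Lemma density_complete (R : realType) (T : finType) (G : sgraph T) (r : nat) :
  density R (complete r) G = (clique_count (adj G) r)%:R / 'C(#|T|, r)%:R.
Proof.
rewrite /density card_ord; congr (_%:R / _); apply: eq_card => X.
by rewrite inE; apply/asboolP/idP => /isomorphic_complete.
Qed.

Lemma density_edgeless (R : realType) (T : finType) (G : sgraph T) (r : nat) :
  density R (edgeless r) G = (clique_count (co_rel (adj G)) r)%:R / 'C(#|T|, r)%:R.
Proof.
rewrite /density card_ord; congr (_%:R / _); apply: eq_card => X.
by rewrite inE; apply/asboolP/idP => /isomorphic_edgeless.
Qed.

Lemma natr_bin (R : numFieldType) (n m : nat) :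
  'C(n, m)%:R = (n ^_ m)%:R / m`!%:R :> R.
Proof. by rewrite -bin_ffact natrM mulfK // pnatr_eq0 -lt0n fact_gt0. Qed.

(** Valid for each [n], as the path estimate has no error term; with fewer than [m.+1] vertices both
    sides are 0. *)
Lemma max_min_density_le (R : realType) (m n : nat) (rho : R) :
  (0 < m)%N -> 0 < rho < 1 -> rho ^+ m.+1 = edgeless_limit m (1 - rho) ->
  max_min_density R m.+1 n <= (rho * n%:R) ^+ m.+1 / (n ^_ m.+1)%:R.
Proof.
move=> m0 rho01 e; have /andP[rho0 rho1] := rho01.
apply: bigmax_le => [|G _].
  by rewrite divr_ge0 // exprn_ge0 // mulr_ge0 // ltW.
rewrite density_complete density_edgeless card_ord ge_min natr_bin.
have [s ss hs] := cliques_le_path (finset.setTfor 'I_n) (adj_sym G) (adj_irr G).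
have [h1 h2] := hs m; rewrite cardsT card_ord in ss.
have bound (c p : nat) : (c <= p)%N -> m.+1`!%:R * p%:R <= (rho * n%:R) ^+ m.+1 ->
    c%:R / ((n ^_ m.+1)%:R / m.+1`!%:R) <= (rho * n%:R) ^+ m.+1 / (n ^_ m.+1)%:R.
  move=> cp hp; rewrite invf_div mulrA ler_wpM2r ?invr_ge0 // mulrC.
  by apply: le_trans hp; rewrite ler_wpM2l // ler_nat.
have := path_binom_min_le s m0 rho01 e; rewrite ss => -[h|h].
  by rewrite (bound _ _ h2 h) orbT.
by rewrite (bound _ _ h1 h).
Qed.

Lemma max_min_density_ge (R : realType) (m n k : nat) : (k <= n)%N ->
  Num.min (k ^_ m.+1)%:R
     (((n - k) ^_ m.+1)%:R + m.+1%:R * k%:R * ((n - k) ^_ m)%:R) / (n ^_ m.+1)%:R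
  <= max_min_density R m.+1 n.
Proof.
move=> /(exists_clique_graph m)[G [hc hi]].
apply: le_trans (le_bigmax _ _ G).
rewrite density_complete density_edgeless card_ord natr_bin invf_div mulrA.
set c := ((n ^_ m.+1)%:R)^-1; have c0 : 0 <= c by rewrite invr_ge0.
have h1 : (k ^_ m.+1)%:R <= (clique_count (adj G) m.+1)%:R * (m.+1)`!%:R :> R.
  by rewrite -natrM ler_nat -bin_ffact leq_mul.
have h2 : ((n - k) ^_ m.+1)%:R + m.+1%:R * k%:R * ((n - k) ^_ m)%:R <=
    (clique_count (co_rel (adj G)) m.+1)%:R * (m.+1)`!%:R :> R.
  apply: (@le_trans _ _ (('C(n - k, m.+1) + k * 'C(n - k, m)) * (m.+1)`!)%:R).
    rewrite -!natrM -natrD ler_nat mulnDl bin_ffact leq_add2l factS -bin_ffact.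
    by rewrite leq_eqVlt; apply/predU1P; left; ring.
  by rewrite -natrM ler_nat leq_mul.
rewrite le_min; apply/andP; split; rewrite ?mulrA ler_wpM2r //.
  by apply: le_trans h1; rewrite ge_min lexx.
by apply: le_trans h2; rewrite ge_min lexx orbT.
Qed.

Lemma cvg_invn (R : realType) : (n%:R^-1 : R) @[n --> \oo] --> (0 : R).
Proof. by rewrite -cvg_shiftS; exact: cvg_harmonic. Qed.

Lemma cvg_min (R : realType) (f g : nat -> R) (l : R) :
  f n @[n --> \oo] --> l -> g n @[n --> \oo] --> l ->
  Num.min (f n) (g n) @[n --> \oo] --> l.
Proof.
move=> /cvgrPdist_lt fl /cvgrPdist_lt gl; apply/cvgrPdist_lt => e e0.
near=> n; rewrite minEle; case: ifP => _; near: n; [exact: fl|exact: gl].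
Unshelve. all: by end_near.
Qed.

(** Each factor (u n - i) / n of the quotient tends to [x], being within i / n of (u n) / n. *)
Lemma cvg_ffact (R : realType) (u : nat -> nat) (x : R) (j : nat) :
  (u n)%:R / n%:R @[n --> \oo] --> x ->
  ((u n) ^_ j)%:R / n%:R ^+ j @[n --> \oo] --> x ^+ j.
Proof.
move=> ux; elim: j => [|j IHj].
  under eq_fun do rewrite ffactn0 !expr0 divr1; exact: cvg_cst.
have -> : (fun n => ((u n) ^_ j.+1)%:R / n%:R ^+ j.+1 : R) =
    (fun n => ((u n) ^_ j)%:R / n%:R ^+ j) \* (fun n => (u n - j)%:R / n%:R).
  apply/funext => n /=; rewrite ffactnSr natrM exprSr.
  by rewrite invfM mulrACA.
rewrite exprSr; apply: cvgM => //.
apply: (@squeeze_cvgr _ _ _ _ (fun n => (u n)%:R / n%:R - j%:R * n%:R^-1)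
  (fun n => (u n)%:R / n%:R)) => //.
  apply: nearW => n; rewrite -mulrBl !ler_wpM2r ?invr_ge0 //.
    by rewrite ler_nat leq_subr.
  by rewrite lerBlDr -natrD ler_nat addnC -leq_subLR.
rewrite -[X in _ --> X]subr0 -(mulr0 j%:R); apply: cvgB => //.
by apply: cvgMl_tmp; exact: cvg_invn.
Qed.

(** From [x] to [y] the left side of the equation strictly increases while the right side does
    not. *)
Lemma critical_unique_lt (R : realType) (m : nat) (x y : R) :
  (0 < m)%N -> 0 <= x -> y <= 1 -> x < y ->
  x ^+ m.+1 = edgeless_limit m (1 - x) -> y ^+ m.+1 = edgeless_limit m (1 - y) -> False.
Proof.
move=> m0 x0 y1 xy ex ey.
have : edgeless_limit m (1 - y) <= edgeless_limit m (1 - x).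
  by apply: edgeless_limit_le => //; lra.
by rewrite -ex -ey leNgt ltrXn2r.
Qed.

Lemma exists_critical (R : realType) (m : nat) : (0 < m)%N ->
  exists2 rho : R, 0 < rho < 1 & rho ^+ m.+1 = edgeless_limit m (1 - rho).
Proof.
move=> m0.
pose p : {poly R} := 'X^(m.+1) -
  ((1 - 'X) ^+ m.+1 + m.+1%:R *: (1 - 'X) ^+ m * (1 - (1 - 'X))).
have pE x : p.[x] = x ^+ m.+1 - edgeless_limit m (1 - x) by rewrite !hornerE.
have p0 : p.[0] = -1.
  by rewrite pE /edgeless_limit subr0 subrr mulr0 addr0 expr0n expr1n sub0r.
have p1 : p.[1] = 1.
  rewrite pE /edgeless_limit subrr expr1n !expr0n /= gtn_eqF //.
  by rewrite mulr0 mul0r addr0 subr0.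
have p01 : p.[0] <= 0 <= p.[1] by rewrite p0 p1 lerN10 ler01.
(* The difference of the two sides goes from -1 at 0 to 1 at 1, so it has a root, and neither end is
   one. *)
have [rho /andP[rho0 rho1] /rootP e] := poly_ivt ler01 p01.
exists rho; last by apply/eqP; rewrite -subr_eq0 -pE e.
rewrite !lt_neqAle rho0 rho1 !andbT; apply/andP; split.
  by apply: contra_eq_neq e => <-; rewrite p0 oppr_eq0 oner_eq0.
by apply: contra_eq_neq e => ->; rewrite p1 oner_eq0.
Qed.

Lemma cvg_max_min_density (R : realType) (m : nat) (rho : R) :
  (0 < m)%N -> 0 < rho < 1 -> rho ^+ m.+1 = edgeless_limit m (1 - rho) ->
  max_min_density R m.+1 n @[n --> \oo] --> rho ^+ m.+1.
Proof.
move=> m0 rho01 e; have /andP[rho0 rho1] := rho01.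
(* The lower bound comes from a clique on a share [rho] of the vertices, rounded down. *)
pose k (n : nat) := Num.truncn (rho * n%:R).
have kle n : (k n)%:R <= rho * n%:R by rewrite truncn_le mulr_ge0 // ltW.
have kn n : (k n <= n)%N.
  by rewrite -(ler_nat R) (le_trans (kle n)) // -[leRHS]mul1r ler_wpM2r // ltW.
have near_pos : \forall n \near \oo, 0 < n%:R :> R.
  by near=> n; rewrite ltr0n; near: n; exact: nbhs_infty_gt.
have ck : (k n)%:R / n%:R @[n --> \oo] --> rho.
  apply: (@squeeze_cvgr _ _ _ _ (fun n => rho - n%:R^-1) (fun=> rho)).
  - near=> n; have n0 : 0 < n%:R :> R by near: n.
    rewrite ler_pdivrMr // kle andbT ler_pdivlMr // mulrBl mulVf ?gt_eqF //.
    by rewrite lerBlDr natr1 ltW // truncnS_gt.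
  - by rewrite -[X in _ --> X]subr0; apply: cvgB; [exact: cvg_cst|exact: cvg_invn].
  - exact: cvg_cst.
have ck' : (n - k n)%:R / n%:R @[n --> \oo] --> 1 - rho.
  apply: (@cvg_trans _ ((1 - (k n)%:R / n%:R : R) @[n --> \oo])).
    apply: near_eq_cvg; near=> n; have n0 : 0 < n%:R :> R by near: n.
    by rewrite natrB // mulrBl divff ?gt_eqF.
  by apply: cvgB => //; exact: cvg_cst.
(* The quotient is 0 at [n = 0], so it equals 1 only eventually. *)
have cn : (n%:R / n%:R : R) @[n --> \oo] --> (1 : R).
  apply: (@cvg_trans _ ((fun=> 1 : R) @ \oo)); last exact: cvg_cst.
  apply: near_eq_cvg; near=> n; have n0 : 0 < n%:R :> R by near: n.
  by rewrite divff ?gt_eqF.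
have c1 := @cvg_ffact R (fun n => n) 1 m.+1 cn; rewrite expr1n in c1.
have c1V : ((n ^_ m.+1)%:R / n%:R ^+ m.+1)^-1 @[n --> \oo] --> (1 : R).
  by rewrite -[X in _ --> X]invr1; apply: cvgV => //; rewrite oner_eq0.
apply: (@squeeze_cvgr _ _ _ _
  (fun n => Num.min ((k n ^_ m.+1)%:R / n%:R ^+ m.+1)
    (((n - k n) ^_ m.+1)%:R / n%:R ^+ m.+1 +
     m.+1%:R * ((k n)%:R / n%:R) * (((n - k n) ^_ m)%:R / n%:R ^+ m)) *
    ((n ^_ m.+1)%:R / n%:R ^+ m.+1)^-1)
  (fun n => rho ^+ m.+1 * ((n ^_ m.+1)%:R / n%:R ^+ m.+1)^-1)).
- near=> n; have n0 : 0 < n%:R :> R by near: n.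
  have nm : 0 < n%:R ^+ m.+1 :> R by rewrite exprn_gt0.
  apply/andP; split.
    apply: le_trans (max_min_density_ge R m (kn n)).
    rewrite invf_div; set a := Num.min _ _; rewrite [a * _]mulrA.
    rewrite ler_wpM2r ?invr_ge0 // /a mulrC minr_pMr ?(ltW nm) //.
    rewrite le_eqVlt; apply/predU1P; left.
    rewrite mulrC divfK ?gt_eqF //; congr (Num.min _ _).
    rewrite !(exprS n%:R); field.
    by rewrite ?expf_neq0 gt_eqF.
  apply: le_trans (max_min_density_le n m0 rho01 e) _.
  by rewrite invf_div exprMn mulrA.
- rewrite -[X in _ --> X]mulr1; apply: cvgM => //.
  apply: cvg_min; first exact: cvg_ffact.
  (* The critical equation gives both arguments of the minimum the same limit. *)
  have -> : rho ^+ m.+1 = (1 - rho) ^+ m.+1 + m.+1%:R * rho * (1 - rho) ^+ m.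
    by rewrite e /edgeless_limit; ring.
  apply: cvgD; first exact: cvg_ffact.
  apply: cvgM; last exact: cvg_ffact.
  by apply: cvgM => //; exact: cvg_cst.
- rewrite -[X in _ --> X]mulr1; apply: cvgM => //; exact: cvg_cst.
Unshelve. all: by end_near.
Qed.

Unset Implicit Arguments.

Theorem theorem1p3 (R : realType) (r : nat) (hr : (2 <= r)%N) :
  exists rho : R,
    unique (fun x : R => 0 <= x <= 1 /\
              x ^+ r = (1 - x) ^+ r + r%:R * x * (1 - x) ^+ r.-1) rho /\
    max_min_density R r n @[n --> \oo] --> rho ^+ r.
Proof.
case: r hr => // m; rewrite ltnS => m0.
have [rho rho01 e] := exists_critical R m0; have /andP[rho0 rho1] := rho01.
have limitE (x : R) : (1 - x) ^+ m.+1 + m.+1%:R * x * (1 - x) ^+ m =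
    edgeless_limit m (1 - x) by rewrite /edgeless_limit; ring.
exists rho; split; last exact: cvg_max_min_density.
split; first by rewrite !ltW //= limitE.
move=> x [/andP[x0 x1]]; rewrite /= limitE => ex.
case: (ltgtP rho x) => // h; exfalso.
- exact: (critical_unique_lt m0 (ltW rho0) x1 h e ex).
- exact: (critical_unique_lt m0 x0 (ltW rho1) h ex e).
Qed.
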